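(* Let $n\ge1$ and $m\ge1$ be integers, and let $\Gamma=([n],A(\Gamma))$ be a simple digraph. Let $\bar\Gamma=([n],A(\bar\Gamma))$ be the complement of $\Gamma$ in the complete loopless digraph on $[n]$, and let $$\mathcal C_n^{m,m}(\Gamma)=\mathcal C_n^m\setminus\{x_i-x_j=m\mid (i,j)\in A(\Gamma)\},$$ an arrangement in $\mathbb R^n$. Then $$\chi(\mathcal C_n^{m,m}(\Gamma),t)=t\sum_{k=1}^{n}(-1)^{n-k}\,\mathrm{path}_k(\bar\Gamma)\,(t-mn+k-1)^{\underline{k-1}}.$$
   Context: Notation: $[n]=\{1,\dots,n\}$. Falling factorial: $x^{\underline r}=x(x-1)\cdots(x-r+1)$, $x^{\underline 0}=1$. The full $m$-Catalan arrangement in $\mathbb R^n$ is the set of hyperplanes $$\mathcal C_n^m=\{x_i-x_j=0\mid 1\le i<j\le n\}\cup\{x_i-x_j=s\mid 1\le i\ne j\le n,\ 1\le s\le m\}.$$ For a finite hyperplane arrangement $\mathcal A$ in $\mathbb R^n$, $L(\mathcal A)$ is the poset of nonempty intersections of subfamilies of $\mathcal A$, ordered by reverse inclusion, with minimum $\hat 0=\mathbb R^n$ (the empty intersection). With $\mu$ the Möbius function of $L(\mathcal A)$, the characteristic polynomial is $\chi(\mathcal A,t)=\sum_{X\in L(\mathcal A)}\mu(\hat 0,X)t^{\dim X}$. A simple digraph has no loops and no repeated arcs (both $(i,j)$ and $(j,i)$ may be present). The complement has arc set $A(\bar\Gamma)=\{(u,v)\in[n]\times[n]\mid u\neq v,\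 (u,v)\notin A(\Gamma)\}$. A path cover of a digraph is a set of vertex-disjoint directed paths covering all vertices, with isolated vertices allowed as paths of length $0$; $\mathrm{path}_k(\cdot)$ is the number of path covers with exactly $k$ directed paths. *)

(* Defs.v *)
From mathcomp Require Import all_boot all_order all_algebra finmap.
From mathcomp Require Import boolp classical_sets cardinality reals.

Set Implicit Arguments.
Unset Strict Implicit.
Unset Printing Implicit Defensive.

Import Order.TTheory GRing.Theory Num.Theory.

Local Open Scope ring_scope.

(* [mobius P le] is the Moebius function of the finite poset [(P, le)]:
   mu(x, x) = 1 and mu(x, y) = - \sum_(x <= z < y) mu(x, z) for x < y.  The
   recursion depth is at most the number of elements of a chain from x to y,
   so #|P| is enough fuel; see [mobiusE]. *)
Fixpoint mobius_rec (T : choiceType) (P : {fset T}) (le : rel T) (k : nat)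
    (x y : T) : int :=
  if k is k'.+1 then
    if x == y then 1
    else if le x y then
      - \sum_(z <- P | [&& le x z, le z y & z != y]) mobius_rec P le k' x z
    else 0
  else 0.

Definition mobius (T : choiceType) (P : {fset T}) (le : rel T) : T -> T -> int :=
  mobius_rec P le #|` P|.

Lemma mobius_rec_fuel (T : choiceType) (P : {fset T}) (le : rel T)
    (le_anti : antisymmetric le) (le_trans : transitive le) (x : T) (k : nat) (y : T) :
  y \in P -> (#|` [fset z in P | le z y]%fset| <= k)%N -> reflexive le ->
  mobius_rec P le k x y = mobius_rec P le k.+1 x y.
Proof.
move=> + + le_refl; elim: k y => [|k IH] y yP hk.
  move: hk; rewrite leqn0 cardfs_eq0 => /eqP /fsetP /(_ y).
  by rewrite !inE /= yP le_refl.
rewrite [LHS]/= [RHS]/=; case: eqP => // _; case: ifP => // _; congr (- _).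
rewrite big_seq_cond [RHS]big_seq_cond; apply: eq_bigr => z.
case/and4P=> zP _ lezy nzy; apply: IH => //.
rewrite -ltnS; apply: leq_trans hk; apply: fproper_ltn_card.
rewrite fproperE; apply/andP; split.
  by apply/fsubsetP => w; rewrite !inE /= => /andP[-> lewz]; exact: le_trans lezy.
apply/negP => /fsubsetP /(_ y); rewrite !inE /= yP le_refl => /(_ isT) leyz.
by move/eqP: nzy; apply; apply: le_anti; rewrite lezy leyz.
Qed.

Lemma mobiusE (T : choiceType) (P : {fset T}) (le : rel T)
    (le_refl : reflexive le) (le_anti : antisymmetric le)
    (le_trans : transitive le) (x y : T) :
  y \in P ->
  mobius P le x y =
    if x == y then 1
    else if le x y then
      - \sum_(z <- P | [&& le x z, le z y & z != y]) mobius P le x z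
    else 0.
Proof.
move=> yP; rewrite /mobius mobius_rec_fuel //.
by apply: fsubset_leq_card; apply/fsubsetP => z; rewrite !inE => /andP[].
Qed.

Local Open Scope classical_set_scope.

(* Nonempty intersections of subfamilies; the empty subfamily gives [setT]. *)
Definition flats (R : realType) (n : nat) (A : set (set 'rV[R]_n)) :
    set (set 'rV[R]_n) :=
  [set X | X !=set0 /\ exists2 B, B `<=` A & X = \bigcap_(H in B) H].

Definition affine_of_dim (R : realType) (n d : nat) (X : set 'rV[R]_n) : Prop :=
  exists (x0 : 'rV[R]_n) (M : 'M[R]_(d, n)),
    row_free M /\ X = [set x | (x - x0 <= M)%MS].

(* The dimension of an affine subspace; junk value 0 on other sets. *)
Definition affine_dim (R : realType) (n : nat) (X : set 'rV[R]_n) : nat :=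
  xget 0%N [set d | affine_of_dim d X].

Definition reverse_incl (T : Type) : rel (set T) :=
  fun X Y => `[< Y `<=` X >].

(* Meaningful for finite [A]: [fset_set] of an infinite set is empty. *)
Definition char_poly_arr (R : realType) (n : nat) (A : set (set 'rV[R]_n)) :
    {poly int} :=
  let L := fset_set (flats A) in
  \sum_(X <- L) mobius L (@reverse_incl _) setT X *: 'X^(affine_dim X).

Definition hyp (R : realType) (n : nat) (i j : 'I_n) (s : nat) : set 'rV[R]_n :=
  [set x | x ord0 i - x ord0 j = s%:R].
Arguments hyp : clear implicits.
Arguments hyp R {n} i j s _.

Definition catalan (R : realType) (n m : nat) : set (set 'rV[R]_n) :=
  [set H | exists i j : 'I_n, (i < j)%N /\ H = hyp R i j 0] `|`
  [set H | exists (i j : 'I_n) (s : nat),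
             [/\ i != j, (1 <= s <= m)%N & H = hyp R i j s]].
Arguments catalan : clear implicits.

Definition catalan_del (R : realType) (n m : nat) (G : rel 'I_n) :
    set (set 'rV[R]_n) :=
  catalan R n m `\` [set H | exists i j : 'I_n, G i j /\ H = hyp R i j m].
Arguments catalan_del : clear implicits.
Arguments catalan_del R {n} m G _.

(* A simple digraph on [T] is an irreflexive relation. *)
Definition digraph_compl (T : finType) (G : rel T) : rel T :=
  fun u v => (u != v) && ~~ G u v.

(* A directed path is given by the sequence of its (distinct) vertices. *)
Definition dipath (T : finType) (G : rel T) (p : seq T) : bool :=
  [&& p != [::], uniq p & sorted G p].

(* Paths have at most #|T| vertices, hence the bounded sequences. *)
Definition path_cover (T : finType) (G : rel T) (C : {set #|T|.-bseq T}) : bool :=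
  [&& [forall p in C, dipath G p],
      [forall p in C, forall q in C, (p != q) ==> [disjoint p & q]]
    & [forall v, exists p in C, v \in p]].

Definition num_path_covers (T : finType) (G : rel T) (k : nat) : nat :=
  #|[pred C : {set #|T|.-bseq T} | path_cover G C & #|C| == k]|.

Definition falling (S : pzRingType) (x : S) (r : nat) : S :=
  \prod_(i < r) (x - i%:R).

(* Main.v *)
Require Import Defs.
From mathcomp Require Import all_boot all_order all_algebra reals.
From mathcomp Require Import zify lra ring.

(** The characteristic polynomial is evaluated at every large integer [q] by
    counting points modulo [q], and the count is expressed through path covers.

    For [q > m n], the value at [q] is the number of maps [f] from the [n]
    indices to Z_q that satisfy none of the equations [f i - f j = s] attached
    to the hyperplanes ([char_poly_eval]).  As [q > m n], the map [f] misses [m]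
    consecutive residues; cutting the circle there lifts [f] to an integer point
    that satisfies exactly the equations that [f] satisfies.  A flat [X] contains
    the lift of [q ^ dim X] maps, because [X] is a coset, through an integer point,
    of the space of vectors constant on the classes of a partition of the
    coordinates.  Moebius inversion over the flats through the lift then selects
    the maps whose lift is on no hyperplane.

    Such an [f] has two properties.  It is spaced: its values are pairwise at
    circular distance at least [m], so that each index occupies [m] cells of a circle of [q] cells, without
    overlap.  And no arc [(i, j)] of the complement digraph is tight, that is,
    satisfies [f i = f j + m].  For a fixed spaced [f] the tight arcs form
    disjoint chains, and the sum of [(-1) ^ (n - k)] over the path covers with
    tight arcs, [k] being the number of paths, is 1 if there is no tight arc and
    0 otherwise ([signed_cover_sum]).  After exchanging sums it remains to count,
    for a path cover with [k] paths, the spaced [f] for which all its arcs are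
    tight.  These place [k] rigid blocks of total length [m n] on the circle:
    there are [q] positions for one block, and the other [k - 1] blocks and the
    [q - m n] free cells can then be ordered in
    [(q - m n + k - 1) ^_ (k - 1)] ways ([card_spaced_tight]).

    Both sides of the identity thus agree at infinitely many integers. *)

Set Implicit Arguments.
Unset Strict Implicit.
Unset Printing Implicit Defensive.
Import Order.TTheory GRing.Theory Num.Theory.

Local Open Scope ring_scope.

(** * Path covers of a set of vertices *)

(** Covers of a vertex subset [U] rather than of all vertices: paths are peeled
    off one at a time, and what remains is a cover of the uncovered vertices. *)
Definition cover_of (T : finType) (E : rel T) (U : {set T})
    (C : {set #|T|.-bseq T}) : bool :=
  [&& [forall p in C, dipath E p],
      [forall p in C, forall q in C, (p != q) ==> [disjoint p & q]]
    & [forall v, (v \in U) == [exists p in C, v \in p]]].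

Lemma cover_ofP (T : finType) (E : rel T) (U : {set T})
    (C : {set #|T|.-bseq T}) :
  reflect [/\ forall p, p \in C -> dipath E p,
              forall p q x, p \in C -> q \in C -> x \in p -> x \in q -> p = q
            & forall x, x \in U <-> exists2 p, p \in C & x \in p]
          (cover_of E U C).
Proof.
apply: (iffP and3P) => [[hp hd hU]|[hp hd hU]]; split.
- by move=> p pC; have /forall_inP/(_ p pC) := hp.
- move=> p q x pC qC xp xq; apply/eqP/negPn/negP => npq.
  have /forall_inP/(_ p pC)/forall_inP/(_ q qC)/implyP/(_ npq) := hd.
  by rewrite disjoint_has => /hasPn /(_ x xp); rewrite xq.
- move=> x; have /forallP/(_ x)/eqP -> := hU; split.
    by case/exists_inP=> p pC xp; exists p.
  by case=> p pC xp; apply/exists_inP; exists p.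
- by apply/forall_inP.
- apply/forall_inP => p pC; apply/forall_inP => q qC; apply/implyP => npq.
  rewrite disjoint_has; apply/hasPn => x xp; apply/negP => xq.
  by move/eqP: npq; apply; apply: hd xp xq.
- apply/forallP => x; apply/eqP; apply/idP/exists_inP.
    by move/hU => [p pC xp]; exists p.
  by case=> p pC xp; apply/hU; exists p.
Qed.

Lemma mem_bseqE (T : eqType) n (p : n.-bseq T) (s : seq T) :
  p = s :> seq T -> p =i s.
Proof. by move=> <-. Qed.

Lemma cover_ofT (T : finType) (E : rel T) (C : {set #|T|.-bseq T}) :
  cover_of E setT C = path_cover E C.
Proof.
by rewrite /cover_of /path_cover; congr [&& _, _ & _]; apply: eq_forallb => v; rewrite inE.
Qed.

Lemma dipath_uniq (T : finType) (E : rel T) p : dipath E p -> uniq p.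
Proof. by case/and3P. Qed.

Lemma dipath_ex_mem (T : finType) (E : rel T) (p : seq T) :
  dipath E p -> exists x, x \in p.
Proof. by case: p => [|x p] // _; exists x; rewrite mem_head. Qed.

Lemma cover_of_del (T : finType) (E : rel T) (U : {set T}) C p :
  cover_of E U C -> p \in C -> cover_of E (U :\: [set x in p]) (C :\ p).
Proof.
move=> /cover_ofP[hp hd hU] pC; apply/cover_ofP; split.
- by move=> q; rewrite !inE => /andP[_ qC]; apply: hp.
- by move=> r q x; rewrite !inE => /andP[_ rC] /andP[_ qC]; apply: hd.
- move=> x; rewrite !inE; split.
    case/andP=> xp /hU [q qC xq]; exists q => //; rewrite !inE qC andbT.
    by apply: contraNneq xp => <-.
  case=> q; rewrite !inE => /andP[nqp qC] xq; apply/andP; split; last by apply/hU; exists q.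
  by apply: contraNN nqp => xp; apply/eqP; apply: hd xq xp.
Qed.

Lemma cover_of_add (T : finType) (E : rel T) (U : {set T}) (C : {set #|T|.-bseq T})
    (p : #|T|.-bseq T) :
  dipath E p -> [set x in p] \subset U -> cover_of E (U :\: [set x in p]) C ->
  cover_of E U (p |: C).
Proof.
move=> dp /subsetP pU /cover_ofP[hp hd hU].
have dis q x : q \in C -> x \in q -> x \notin p.
  move=> qC xq; have /hU : exists2 q, q \in C & x \in q by exists q.
  by rewrite !inE => /andP[].
apply/cover_ofP; split.
- by move=> q; rewrite !inE => /predU1P[->|/hp].
- move=> r q x; rewrite !inE => /predU1P[->|rC] /predU1P[->|qC] // xr xq.
  + by have := dis _ _ qC xq; rewrite xr.
  + by have := dis _ _ rC xr; rewrite xq.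
  + exact: hd xr xq.
- move=> x; split.
    move=> xU; case: (boolP (x \in p)) => xp; first by exists p; rewrite ?setU11.
    have /hU [q qC xq] : x \in U :\: [set x in p] by rewrite !inE xp.
    by exists q => //; rewrite !inE qC orbT.
  case=> q; rewrite !inE => /predU1P[->|qC] xq; first by apply: pU; rewrite inE.
  have /hU : exists2 q, q \in C & x \in q by exists q.
  by rewrite inE => /andP[].
Qed.

Lemma cover_of_sub (T : finType) (E : rel T) (U : {set T}) C p :
  cover_of E U C -> p \in C -> [set x in p] \subset U.
Proof.
move=> /cover_ofP[_ _ hU] pC; apply/subsetP => x; rewrite inE => xp.
by apply/hU; exists p.
Qed.

Lemma cover_of_notin (T : finType) (E : rel T) (U : {set T}) C
    (p : #|T|.-bseq T) u :
  u \in p -> cover_of E (U :\: [set x in p]) C -> p \notin C.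
Proof.
move=> up /cover_ofP[_ _ hU]; apply/negP => pC.
have /hU : exists2 q, q \in C & u \in q by exists p.
by rewrite !inE up.
Qed.

(** Exactly one path [p] of a cover passes through a given vertex [u]; a cover
    is the choice of [p] together with a cover of the vertices off [p]. *)
Lemma cover_sum_rec (T : finType) (E : rel T) (U : {set T}) u
    (F : {set #|T|.-bseq T} -> int) : u \in U ->
  \sum_(C | cover_of E U C) F C =
  \sum_(p : #|T|.-bseq T | [&& dipath E p, u \in p & [set x in p] \subset U])
     \sum_(C | cover_of E (U :\: [set x in p]) C) F (p |: C).
Proof.
move=> uU.
pose part (C : {set #|T|.-bseq T}) := odflt [bseq] [pick p in C | u \in p].
have partP C : cover_of E U C -> part C \in C /\ u \in part C.
  rewrite /part => /cover_ofP[_ _ hU]; case: pickP => [p /andP[]//|no].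
  by have /hU[p pC up] := uU; have := no p; rewrite pC up.
rewrite (partition_big part (fun p : #|T|.-bseq T =>
  [&& dipath E p, u \in p & [set x in p] \subset U])) /=.
  apply: eq_bigr => p /and3P[dp up pU].
  rewrite (reindex_onto (fun C => p |: C) (fun C => C :\ p)) /=; last first.
    by move=> C /andP[CU /eqP <-]; rewrite setD1K //; case: (partP C CU).
  apply: eq_bigl => C; apply/idP/idP.
    case/andP=> /andP[CU _] /eqP <-.
    by apply: cover_of_del CU _; rewrite setU11.
  move=> CU; have CU' := cover_of_add dp pU CU.
  rewrite CU' setU1K ?eqxx ?andbT /=; last exact: cover_of_notin up CU.
  have [pC up'] := partP _ CU'; move/cover_ofP: (CU') => [_ hd _].
  by apply/eqP; apply: hd up' up; rewrite ?setU11.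
move=> C CU; have [pC up] := partP C CU; rewrite up (cover_of_sub CU pC).
by move/cover_ofP: CU => [/(_ _ pC) -> _ _].
Qed.

Lemma cover_of_set0 (T : finType) (E : rel T) C :
  cover_of E set0 C = (C == set0).
Proof.
apply/cover_ofP/eqP => [[hp _ hU]|->].
  apply/setP => p; rewrite inE; apply/negP => pC.
  have [x xp] := dipath_ex_mem (hp p pC).
  have /hU : exists2 p, p \in C & x \in p by exists p.
  by rewrite inE.
by split=> [p|p q x|x]; rewrite ?inE //; split=> // -[p]; rewrite inE.
Qed.

Lemma cover_of_card_gt0 (T : finType) (E : rel T) (U : {set T}) C :
  cover_of E U C -> (0 < #|U|)%N -> (0 < #|C|)%N.
Proof.
move=> CU /card_gt0P[x xU]; move/cover_ofP: CU => [_ _ hU].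
by have /hU [p pC _] := xU; apply/card_gt0P; exists p.
Qed.

Lemma dipath_source (T : finType) (E : rel T) (U : {set T}) u (p : seq T) :
  {in U, forall x, ~~ E x u} -> {subset p <= U} -> dipath E p -> u \in p ->
  p = u :: behead p.
Proof.
case: p => [|x p] // src sub /and3P[_ _ hp] /=.
rewrite inE => /predU1P[-> //|up]; exfalso.
case/splitPr: up hp sub => p1 p2; rewrite /= cat_path /= => /and3P[_ e _] sub.
have /src : last x p1 \in U by apply: sub; rewrite -cat_cons mem_cat mem_last.
by rewrite e.
Qed.

(** When the arcs of [E] form disjoint chains, covers by paths of [E] amount to
    subsets of its arcs (those used), with one path fewer for each arc used; so
    the alternating sum over covers vanishes as soon as there is an arc.  The
    induction removes the path through a source [u]: if [u] has a successor
    [v], the paths from [u] other than the single vertex are [u] followed by a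
    path from the new source [v], and the two contributions cancel. *)
Lemma signed_cover_sum (T : finType) (E : rel T) (y : T -> nat)
    (decr : forall x z, E x z -> (y z < y x)%N)
    (Efun : forall x z z', E x z -> E x z' -> z = z')
    (Einj : forall x x' z, E x z -> E x' z -> x = x') (U : {set T}) :
  \sum_(C | cover_of E U C) (-1) ^+ #|C| =
  (-1) ^+ #|U| *+ [forall x in U, forall z in U, ~~ E x z] :> int.
Proof.
have [k] := ubnP #|U|; elim: k U => // k IH U leUk.
have [->|[v0 v0U]] := set_0Vmem U.
  rewrite (eq_bigl (pred1 set0)) => [|C]; last by rewrite cover_of_set0.
  rewrite big_pred1_eq !cards0 expr0.
  by rewrite (_ : [forall x in _, _]) //; apply/forall_inP => x; rewrite inE.
(* a vertex of largest potential has no predecessor *)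
case: (arg_maxnP y v0U) => u uU umax {v0 v0U}; have {}uU : u \in U := uU.
have src : {in U, forall x, ~~ E x u}.
  by move=> x xU; apply/negP => /decr lt; have /= := umax x xU; rewrite leqNgt lt.
have IHD (p : #|T|.-bseq T) : u \in p ->
  \sum_(C | cover_of E (U :\: [set x in p]) C) (-1) ^+ #|C| =
  (-1) ^+ #|U :\: [set x in p]| *+
    [forall x in U :\: [set x in p], forall z in U :\: [set x in p], ~~ E x z] :> int.
  move=> up; apply: IH; rewrite -ltnS; apply: leq_trans leUk; rewrite ltnS.
  apply: proper_card; apply/properP; split; first exact: subsetDl.
  by exists u; rewrite // !inE up.
rewrite (cover_sum_rec E _ uU) /=.
have sgn (p : #|T|.-bseq T) : u \in p ->
    \sum_(C | cover_of E (U :\: [set x in p]) C) (-1) ^+ #|p |: C| =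
    - \sum_(C | cover_of E (U :\: [set x in p]) C) (-1) ^+ #|C| :> int.
  move=> up; rewrite -sumrN; apply: eq_bigr => C CU.
  by rewrite cardsU1 (cover_of_notin up CU) exprS mulN1r.
have card_gt0 : (0 < #|T|)%N by apply/card_gt0P; exists u.
have u1P : (size [:: u] <= #|T|)%N by [].
pose u1 : #|T|.-bseq T := Bseq u1P.
have u1D : U :\: [set x in u1] = U :\ u.
  by congr (_ :\: _); apply/setP => x; rewrite !inE.
have u_u1 : u \in u1 by rewrite inE.
have sum_u1 : \sum_(C | cover_of E (U :\ u) C) (-1) ^+ #|C| = 
     (-1) ^+ #|U :\ u| *+ [forall x in U :\ u, forall z in U :\ u, ~~ E x z] :> int.
  by rewrite -u1D; apply: IHD.
have bigD : \sum_(p : #|T|.-bseq T | [&& dipath E p, u \in p & [set x in p] \subset U])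
     \sum_(C | cover_of E (U :\: [set x in p]) C) (-1) ^+ #|p |: C| =
  - (\sum_(C | cover_of E (U :\ u) C) (-1) ^+ #|C|) -
  \sum_(p : #|T|.-bseq T | [&& dipath E p, u \in p & [set x in p] \subset U] && (p != u1))
     \sum_(C | cover_of E (U :\: [set x in p]) C) (-1) ^+ #|C| :> int.
  rewrite (bigD1 u1) /=; last first.
    by rewrite /dipath u_u1; apply/subsetP => x; rewrite !inE => /eqP->.
  rewrite sgn // u1D; congr (_ + _).
  by rewrite -sumrN; apply: eq_bigr => p /andP[/and3P[_ up _] _]; apply: sgn.
rewrite bigD.
have [/exists_inP[v vU Euv]|noarc] := boolP [exists v in U, E u v].
- have -> : [forall x in U, forall z in U, ~~ E x z] = false.
    by apply/negbTE/negP => /forall_inP/(_ u uU)/forall_inP/(_ v vU); rewrite Euv.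
  have vU' : v \in U :\ u.
    by rewrite !inE vU andbT; apply/eqP => e; have := decr _ _ Euv; rewrite e ltnn.
  have srcv : {in U :\ u, forall x, ~~ E x v}.
    move=> x; rewrite !inE => /andP[nxu _]; apply: contraNN nxu => Exv.
    exact/eqP/(Einj _ _ _ Exv Euv).
  rewrite [X in - X](cover_sum_rec E (fun C => (-1) ^+ #|C|) vU') /=.
  apply/eqP; rewrite mulr0n subr_eq0; apply/eqP.
  (* paths from [u] of length at least 1 are the paths from [v], with [u] prepended *)
  pose cons_u (p : #|T|.-bseq T) := insub_bseq #|T| (u :: p).
  have cons_uE (s : seq T) : uniq (u :: s) -> insub_bseq #|T| (u :: s) = u :: s :> seq T.
    move=> /card_uniqP e; rewrite insubdK // -topredE.
    by move: (max_card (mem (u :: s))); rewrite e.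
  have beheadE (p : #|T|.-bseq T) : insub_bseq #|T| (behead p) = behead p :> seq T.
    by rewrite insubdK // -topredE /= size_behead (leq_trans (leq_pred _)) // size_bseq.
  apply/esym; rewrite (reindex_onto cons_u
    (fun p : #|T|.-bseq T => insub_bseq #|T| (behead p))) /=; last first.
    move=> p /andP[/and3P[dp up /subsetP pU] _].
    have sub : {subset p <= U} by move=> x xp; apply: pU; rewrite inE.
    have pE := dipath_source src sub dp up.
    by apply: val_inj; rewrite /= /cons_u beheadE cons_uE -pE // (dipath_uniq dp).
  apply/esym; rewrite -sumrN; apply: eq_big => [p|p /and3P[dp vp pU]]; last first.
    have nup : u \notin p.
      apply/negP => up; have /subsetP/(_ u) := pU.
      by rewrite !inE up eqxx => /(_ isT).
    have cE : cons_u p = u :: p :> seq T by rewrite cons_uE //= nup (dipath_uniq dp).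
    rewrite -sumrN; apply: eq_big => [C|C CU].
      congr (cover_of _ _ _); apply/setP => x.
      by rewrite !in_set (mem_bseqE cE) inE negb_or; case: (x == u); rewrite ?andbF.
    by rewrite cardsU1 (cover_of_notin vp CU) exprS mulN1r opprK.
  apply/idP/idP => [/and3P[dp vp /subsetP pU]|].
    have nup : u \notin p.
      apply/negP => up; have := pU u.
      by rewrite !inE up eqxx => /(_ isT).
    have sub : {subset p <= U :\ u} by move=> x xp; apply: pU; rewrite inE.
    have pE := dipath_source srcv sub dp vp.
    have cE : cons_u p = u :: p :> seq T by rewrite cons_uE //= nup (dipath_uniq dp).
    apply/andP; split; last first.
      by apply/eqP/val_inj; rewrite /= beheadE cE.
    rewrite (mem_bseqE cE) mem_head cE /=; apply/andP; split; last first.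
      by apply/eqP => /(congr1 val); rewrite /= cE pE.
    apply/andP; split; last first.
      apply/subsetP => x; rewrite in_set (mem_bseqE cE) inE => /predU1P[-> //|/sub].
      by rewrite !inE => /andP[].
    rewrite /dipath /= nup (dipath_uniq dp) /=.
    by case/and3P: dp => _ _; rewrite pE /= Euv.
  case/andP=> /andP[/and3P[dp up /subsetP pU] np] /eqP hp.
  have sub : {subset cons_u p <= U} by move=> x xp; apply: pU; rewrite inE.
  have := dipath_source src sub dp up.
  rewrite -beheadE hp => cE; rewrite cE in dp sub.
  case: p cE np hp dp sub {pU up} => -[|x p] i cE np hp.
    by case/eqP: np; apply: val_inj; rewrite /= cE.
  case/and3P=> _ /= /andP[nup xp] /andP[Eux px] sub.
  rewrite (Efun _ _ _ Euv Eux) mem_head /dipath /= xp px /=.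
  apply/subsetP => z; rewrite in_set => zp.
  have zU : z \in U by apply: sub; rewrite (mem_bseqE cE) in_cons; apply/orP; right.
  rewrite in_setD1 zU andbT.
  by apply: contraNneq nup => <-.
- rewrite [X in _ - X]big_pred0 ?subr0; last first.
    move=> p; apply/negP => /andP[/and3P[dp up /subsetP pU] np].
    have sub : {subset p <= U} by move=> x xp; apply: pU; rewrite inE.
    have := dipath_source src sub dp up.
    case: p dp up pU np sub => -[|x [|z p]] // i dp up pU np sub [xu].
      by move/eqP: np; case; apply: val_inj; rewrite /= xu.
    have zp : z \in [:: x, z & p] by rewrite !inE eqxx orbT.
    case/negP: noarc; apply/exists_inP; exists z; first exact: sub zp.
    by rewrite -xu; case/and3P: dp => _ _ /=/andP[].
  rewrite sum_u1 (cardsD1 u U) uU /= add1n exprS mulN1r mulNrn; congr (- (_ *+ nat_of_bool _)).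
  apply/forall_inP/forall_inP => h x xU; apply/forall_inP => z zU.
    have [->|nxu] := eqVneq x u.
      apply: contraNN noarc => Euz; apply/exists_inP; by exists z.
    have [->|nzu] := eqVneq z u; first exact: src.
    have xU' : x \in U :\ u by rewrite in_setD1 nxu.
    have zU' : z \in U :\ u by rewrite in_setD1 nzu.
    by have /forall_inP/(_ z zU') := h x xU'.
  move: xU zU; rewrite !inE => /andP[_ xU] /andP[_ zU].
  by have /forall_inP/(_ z zU) := h x xU.
Qed.

(** * Placements of tight paths on a line *)

Local Open Scope nat_scope.

(** Positions along a path decrease: an arc [(x, z)] is tight when [x] comes
    exactly [m] cells after [z], as in the hyperplane [x_i - x_j = m] of an arc
    [(i, j)]. *)
Definition tight (T : eqType) (m : nat) (f : T -> nat) : rel T :=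
  fun x z => f x == f z + m.

(** Linear model: each vertex of [U] occupies [m] cells, starting at its value,
    inside the window from [a] to [q.+1], without overlap and with all arcs of
    the paths of [C] tight.  Outside [U] the function is pinned to [h], so that
    positioned vertices can be moved out of [U] without changing the function
    space. *)
Definition placed (T : finType) (q m a : nat) (U : {set T})
    (C : {set #|T|.-bseq T}) (h f : {ffun T -> 'I_q.+1}) : bool :=
  [&& [forall x, (x \notin U) ==> (f x == h x)],
      [forall x in U, (a <= f x) && (f x + m <= q.+1)],
      [forall x in U, forall z in U,
         (x != z) ==> (f x + m <= f z) || (f z + m <= f x)]
    & [forall p in C, sorted (tight m (fun x => f x)) p]].

Lemma placedP (T : finType) (q m a : nat) (U : {set T})
    (C : {set #|T|.-bseq T}) (h f : {ffun T -> 'I_q.+1}) :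
  reflect [/\ forall x, x \notin U -> f x = h x,
              forall x, x \in U -> a <= f x /\ f x + m <= q.+1,
              forall x z, x \in U -> z \in U -> x != z ->
                f x + m <= f z \/ f z + m <= f x
            & forall p, p \in C -> sorted (tight m (fun x => f x)) p]
          (placed m a U C h f).
Proof.
apply: (iffP and4P) => [] [H1 H2 H3 H4]; split.
- by move=> x xU; have /forallP/(_ x)/implyP/(_ xU)/eqP := H1.
- by move=> x xU; have /forall_inP/(_ x xU)/andP := H2.
- move=> x z xU zU xz.
  by have /forall_inP/(_ x xU)/forall_inP/(_ z zU)/implyP/(_ xz)/orP := H3.
- by move=> p pC; have /forall_inP/(_ p pC) := H4.
- by apply/forallP => x; apply/implyP => /H1 ->.
- by apply/forall_inP => x /H2 /andP.
- apply/forall_inP => x xU; apply/forall_inP => z zU; apply/implyP => xz.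
  by apply/orP; apply: H3.
- by apply/forall_inP.
Qed.

Lemma tight_nth (T : eqType) m (f : T -> nat) (p : seq T) x0 :
  sorted (tight m f) p -> forall i, i < size p ->
  f (nth x0 p i) = f (last x0 p) + m * (size p - i.+1).
Proof.
elim: p => [|x p IH] //= hp i.
case: p hp IH => [|z p] /=.
  by move=> _ _; case: i => //= _; rewrite subnn muln0 addn0.
case/andP=> /eqP xz hp IH; case: i => [_|i lt] /=; last first.
  by rewrite (IH hp i lt) subSS.
by rewrite xz (IH hp 0 isT) subSS subn0 subSS subn0 mulnS; lia.
Qed.

(** A tight path is rigid, so it is located by its lowest cell. *)
Lemma tight_nth_min (T : eqType) m a (f : T -> nat) (p : seq T) x0 :
  sorted (tight m f) p -> {in p, forall x, a <= f x} ->
  has (fun x => f x == a) p -> forall i, i < size p ->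
  f (nth x0 p i) = a + m * (size p - i.+1).
Proof.
move=> hp age /hasP[x xp /eqP fx] i ltip.
have := tight_nth x0 hp ltip; have := nth_index x0 xp => xE.
have lx : index x p < size p by rewrite index_mem.
have := tight_nth x0 hp lx; rewrite xE fx => aE ->.
have : a <= f (last x0 p).
  by apply: age; case: (p) xp => // z s _; rewrite /= mem_last.
by move: aE; case: (m * (size p - _)) => *; lia.
Qed.

Lemma leq_muln_step m a b : a < b -> m * a + m <= m * b.
Proof. by move=> ab; rewrite addnC -mulnS leq_mul2l ab orbT. Qed.

(** The pinning function once [p] has been put with its last vertex at [a]. *)
Definition place_path (T : finType) (q m a : nat) (p : seq T)
    (h : {ffun T -> 'I_q.+1}) : {ffun T -> 'I_q.+1} :=
  [ffun x => if x \in p then inord (a + m * (size p - (index x p).+1)) else h x].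

(** A path whose lowest vertex sits at the left end [a] of the window fills the
    first [m * size p] cells; freezing it leaves a placement of the other paths
    in the remaining window. *)
Lemma placed_path (T : finType) (E : rel T) (q m a : nat) (U : {set T})
    (C : {set #|T|.-bseq T}) (h f : {ffun T -> 'I_q.+1}) (p : #|T|.-bseq T) :
  0 < m -> cover_of E U C -> p \in C ->
  placed m a U C h f && has (fun x => f x == a :> nat) p =
  (a + m * size p <= q.+1) &&
  placed m (a + m * size p) (U :\: [set x in p]) (C :\ p) (place_path m a p h) f.
Proof.
move=> m0 CU pC; have /cover_ofP[hp hd hU] := CU.
have up := dipath_uniq (hp p pC).
have [x0 x0p] := dipath_ex_mem (hp p pC).
have pU x : x \in p -> x \in U by move=> xp; apply/hU; exists p.
have sp : 0 < size p by case: (val p) x0p.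
have idx x : x \in p -> m * (size p - (index x p).+1) + m <= m * size p.
  move=> xp; apply: leq_muln_step.
  by have := index_mem x p; rewrite xp; lia.
apply/andP/andP => [[/placedP[H1 H2 H3 H4] hasa]|[le /placedP[H1 H2 H3 H4]]].
- have nthE := tight_nth_min x0 (H4 p pC) (fun x xp => proj1 (H2 x (pU x xp))) hasa.
  have fE x : x \in p -> f x = a + m * (size p - (index x p).+1) :> nat.
    by move=> xp; rewrite -[in LHS](nth_index x0 xp) nthE ?index_mem.
  split.
    have := nthE 0 sp; have [_] := H2 _ (pU _ (mem_nth x0 sp)) => + e.
    by rewrite e -(prednK sp) subSS subn0 mulnS; lia.
  apply/placedP; split.
  + move=> x; rewrite in_setD in_set negb_and negbK ffunE.
    case: ifP => [xp _|_ /= /H1//]; apply/val_inj.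
    rewrite /= fE // inordK // -fE //.
  + move=> x; rewrite in_setD in_set => /andP[nxp xU].
    have [ax xq] := H2 x xU; split=> //.
    (* another vertex beyond the first [t] vertices of the path is also beyond
       the next one, as only [m] cells separate consecutive vertices *)
    suff H t : t <= size p -> a + m * t <= f x by exact: H.
    elim: t => [|t IH] lt; first by rewrite muln0 addn0.
    have := IH (ltnW lt); have lt' : size p - t.+1 < size p by lia.
    have := nthE _ lt'; rewrite (_ : size p - (size p - t.+1).+1 = t); last by lia.
    have zp := mem_nth x0 lt'; set z := nth _ _ _ in zp * => fz.
    have /H3 : x != z by apply: contraNneq nxp => ->.
    by move/(_ xU (pU z zp)); rewrite fz mulnS; lia.
  + by move=> x z; rewrite !in_setD => /andP[_ xU] /andP[_ zU]; apply: H3.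
  + by move=> r; rewrite in_setD1 => /andP[_ /H4].
- have fE x : x \in p -> f x = a + m * (size p - (index x p).+1) :> nat.
    move=> xp; rewrite H1; last by rewrite in_setD in_set xp.
    rewrite ffunE xp inordK //; have := idx x xp; lia.
  split; last first.
    have lp : last x0 p \in p by rewrite -nth_last; apply: mem_nth; rewrite prednK.
    apply/hasP; exists (last x0 p) => //; apply/eqP; rewrite fE //.
    by rewrite -nth_last index_uniq ?prednK // subnn muln0 addn0.
  apply/placedP; split.
  + move=> x xU; rewrite H1; last by rewrite in_setD (negbTE xU) andbF.
    by rewrite ffunE; case: ifP => // /pU; rewrite (negbTE xU).
  + move=> x xU; case: (boolP (x \in p)) => xp.
      by rewrite fE // leq_addr -addnA (leq_trans _ le) // leq_add2l idx.
    have /H2[le1 ->] : x \in U :\: [set x in p] by rewrite in_setD in_set xp.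
    by split=> //; apply: leq_trans le1; apply: leq_addr.
  + have out x z : x \in p -> z \in U -> z \notin p -> f x + m <= f z.
      move=> xp zU zp; have /H2[+ _] : z \in U :\: [set x in p] by rewrite in_setD in_set zp.
      by rewrite (fE x xp) -addnA; apply: leq_trans; rewrite leq_add2l idx.
    move=> x z xU zU xz; case: (boolP (x \in p)) => xp; case: (boolP (z \in p)) => zp.
    * rewrite !fE //.
      have : index x p != index z p.
        by apply: contraNneq xz => e; rewrite -(nth_index x0 xp) e nth_index.
      have lx : index x p < size p by rewrite index_mem.
      have lz : index z p < size p by rewrite index_mem.
      by rewrite neq_ltn => /orP[] lt; [right|left]; rewrite -addnA leq_add2l;
        apply: leq_muln_step; apply: ltn_sub2l => //; apply: leq_ltn_trans lt _.
    * by left; apply: out.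
    * by right; apply: out.
    * by apply: H3; rewrite // in_setD in_set ?xp ?zp.
  + move=> r rC; have [->|nrp] := eqVneq r p; last by apply: H4; rewrite in_setD1 nrp.
    apply/(sortedP x0) => i lt; rewrite /tight !fE ?mem_nth ?index_uniq // ?(ltnW lt) //.
    by rewrite -(subnSK lt) mulnS addnA addnAC.
Qed.

(** The recursion that [card_placed] follows: an arrangement of [k.+1] blocks
    starts with an empty cell or with one of the blocks. *)
Lemma ffact_rec s k : k < s -> s ^_ k.+1 = s.-1 ^_ k.+1 + k.+1 * s.-1 ^_ k.
Proof.
case: s => // s lks; rewrite ffactSS ffactnSr /= mulnC -[in RHS](mulnC (s ^_ k)) -mulnDr.
by congr (_ * _); lia.
Qed.

Lemma card_sum_bool (X : finType) (P : pred X) :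
  #|[pred x | P x]| = \sum_x (P x).
Proof. by rewrite -sum1_card big_mkcond; apply: eq_bigr => x _; rewrite inE; case: (P x). Qed.

Lemma card_dipath (T : finType) (E : rel T) (U : {set T}) C (p : #|T|.-bseq T) :
  cover_of E U C -> p \in C -> size p + #|U :\: [set x in p]| = #|U|.
Proof.
move=> CU pC; rewrite -(cardsID [set x in p] U) (setIidPr (cover_of_sub CU pC)).
move/cover_ofP: CU => [hp _ _]; have /card_uniqP <- := dipath_uniq (hp p pC).
by congr (_ + _); rewrite cardsE.
Qed.

(** Either cell [a] is free, or a unique path starts there. *)
Lemma placed_split (T : finType) (E : rel T) (q m a : nat) (U : {set T})
    (C : {set #|T|.-bseq T}) (h f : {ffun T -> 'I_q.+1}) :
  0 < m -> cover_of E U C ->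
  placed m a U C h f = placed m a.+1 U C h f +
   \sum_(p in C) (placed m a U C h f && has (fun x => f x == a :> nat) p) :> nat.
Proof.
move=> m0 CU; have /cover_ofP[_ hd hU] := CU.
case: (boolP (placed m a U C h f)) => [/placedP[H1 H2 H3 H4]|nP] /=; last first.
  rewrite big1_eq addn0; case: (boolP (placed _ _ _ _ _ _)) => //.
  move=> /placedP[H1 H2 H3 H4]; case/negP: nP; apply/placedP; split=> // x /H2[lt le].
  by split=> //; apply: ltnW.
have [/exists_inP[x xU /eqP fx]|nx] := boolP [exists x in U, f x == a :> nat].
  have /hU[p pC xp] := xU.
  rewrite (bigD1 p) //= big1 => [|r /andP[rC nrp]].
    rewrite (_ : has _ p) ?addn0; last by apply/hasP; exists x; rewrite // fx.
    case: (boolP (placed _ _ _ _ _ _)) => // /placedP[_ /(_ x xU)[]].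
    by rewrite fx ltnn.
  case: hasP => // -[z zr /eqP fz]; case/eqP: nrp.
  have zU : z \in U by apply/hU; exists r.
  have xz : x = z.
    by apply/eqP/negPn/negP => xz; have [] := H3 x z xU zU xz; rewrite fx fz; lia.
  by apply: hd zr _ ; rewrite // -xz.
rewrite big1 => [|p pC].
  rewrite addn0 (_ : placed m a.+1 U C h f) //; apply/placedP; split=> // x xU.
  have [ax ->] := H2 x xU; split=> //; rewrite ltn_neqAle ax andbT.
  by apply: contraNneq nx => e; apply/exists_inP; exists x; rewrite // e.
case: hasP => // -[x xp /eqP fx]; case/negP: nx; apply/exists_inP; exists x; rewrite ?fx //.
by apply/hU; exists p.
Qed.

(** Arrangements of [k] distinct blocks of total length [m * #|U|] in a window of
    [q.+1 - a] cells: with [r] free cells there are [(r + k)!/r!] of them,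
    whatever the individual lengths.  Truncated subtraction gives the right
    value 0 when the blocks do not fit. *)
Lemma card_placed (T : finType) (E : rel T) (q m a : nat) (U : {set T})
    (C : {set #|T|.-bseq T}) (h : {ffun T -> 'I_q.+1}) :
  0 < m -> cover_of E U C -> a <= q.+1 ->
  #|[pred f | placed m a U C h f]| =
  (q.+1 + #|C| - (a + m * #|U|)) ^_ #|C|.
Proof.
move=> m0; have [d] := ubnP (q.+1 - a).
elim: d a U C h => // d IH a U C h lead CU leaq.
have [U0|[x0 x0U]] := set_0Vmem U.
  move: CU; rewrite U0 cover_of_set0 => /eqP ->; rewrite !cards0 ffactn0.
  apply: (eq_card1 (x := h)) => f; rewrite !inE.
  apply/placedP/eqP => [[H1 _ _ _]|->]; first by apply/ffunP => x; rewrite H1 ?inE.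
  by split=> [//|x|x z|p]; rewrite inE.
have U0 : 0 < #|U| by apply/card_gt0P; exists x0.
have C0 := cover_of_card_gt0 CU U0.
have [aq|aq] := ltnP q a.
  rewrite ffact_small; last first.
    by have : 0 < m * #|U|; [rewrite muln_gt0 m0 | lia].
  apply: eq_card0 => f; rewrite !inE; apply/placedP => -[_ /(_ x0 x0U)[]].
  by lia.
rewrite card_sum_bool (eq_bigr _ (fun f _ => placed_split a h f m0 CU)).
rewrite big_split /= -card_sum_bool (IH a.+1) //; last by lia.
rewrite exchange_big /=.
have step p : p \in C ->
  \sum_f (placed m a U C h f && has (fun x => f x == a :> nat) p) =
   (a + m * size p <= q.+1) * (q.+1 + #|C|.-1 - (a + m * #|U|)) ^_ #|C|.-1.
  move=> pC; rewrite (eq_bigr _ (fun f _ => congr1 nat_of_bool (placed_path a h f m0 CU pC))).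
  have cp := card_dipath CU pC.
  case: leqP => le; last by rewrite /= big1_eq.
  rewrite /= mul1n -card_sum_bool (IH _ _ _ _ _ (cover_of_del CU pC) le).
    by rewrite -cp mulnDr addnA (cardsD1 p C) pC.
  have : 0 < size p.
    by move/cover_ofP: CU => [/(_ p pC) + _ _]; case: (val p).
  by rewrite -(ltn_pmul2l m0) muln0; lia.
have : #|C| = #|C|.-1.+1 by rewrite prednK.
rewrite (eq_bigr _ step); move: (#|C|.-1) {step} => k Ck; rewrite Ck.
have [big|small] := leqP (a + m * #|U|) q.+1.
  rewrite (eq_bigr (fun=> (q.+1 + k - (a + m * #|U|)) ^_ k)) => [|p pC]; last first.
    have cp := card_dipath CU pC.
    by rewrite (leq_trans _ big) ?mul1n // leq_add2l leq_mul2l -cp leq_addr orbT.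
  rewrite sum_nat_const Ck [in RHS]ffact_rec; last by lia.
  by congr (_ ^_ _ + _ * _ ^_ _); lia.
rewrite [RHS]ffact_small; last by lia.
rewrite ffact_small ?add0n; last by lia.
apply: big1 => p pC.
case: leqP => le; rewrite ?mul0n // mul1n ffact_small //.
have cp := card_dipath CU pC.
have lt : size p < #|U|.
  by rewrite -(ltn_pmul2l m0); lia.
have := cover_of_card_gt0 (cover_of_del CU pC); have := cardsD1 p C; rewrite pC.
by lia.
Qed.

(** * Placements on a circle *)

(** With representatives in [0, q), a congruence [u - v = s] either holds between
    natural numbers or wraps around once. *)
Lemma Zp_subE p (u v : 'I_p.+2) s : s < p.+2 ->
  (u - v == s%:R)%R <-> (u = v + s :> nat) \/ (u + p.+2 = v + s :> nat).
Proof.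
move=> sp; rewrite GRing.subr_eq GRing.addrC -val_eqE /=.
have -> : (s%:R : 'I_p.+2)%R = s :> nat by rewrite Zp_nat /= modn_small.
have := ltn_ord u; have := ltn_ord v; move: (u : nat) (v : nat) => {u v} a b bp ap.
have [lt|ge] := ltnP (b + s) p.+2.
  by rewrite modn_small //; split; [move/eqP; left | case=> ?; apply/eqP; lia].
rewrite -(subnK ge) modnDr modn_small; last by lia.
by split; [move/eqP; right; lia | case=> ?; apply/eqP; lia].
Qed.

Lemma Zp_addE p (u v : 'I_p.+2) s : s < p.+2 ->
  (u == v + s%:R)%R <-> (u = v + s :> nat) \/ (u + p.+2 = v + s :> nat).
Proof. by move=> sp; rewrite GRing.addrC -GRing.subr_eq; apply: Zp_subE. Qed.

Definition spaced (T : finType) p (m : nat) (f : {ffun T -> 'I_p.+2}) : bool :=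
  [forall x, forall z, (x != z) ==> [forall s : 'I_m, (f x - f z != s%:R)%R]].

Lemma spacedP (T : finType) p (m : nat) (f : {ffun T -> 'I_p.+2}) :
  reflect (forall x z s, x != z -> s < m -> (f x - f z != s%:R)%R) (spaced m f).
Proof.
apply: (iffP forallP) => [H x z s xz sm|H x].
  by have /forallP/(_ z)/implyP/(_ xz)/forallP/(_ (Ordinal sm)) := H x.
by apply/forallP => z; apply/implyP => xz; apply/forallP => s; apply: H.
Qed.

Definition cyc_tight (T : finType) p (m : nat) (f : {ffun T -> 'I_p.+2}) : rel T :=
  fun x z => (f x == f z + m%:R)%R.

(** Cutting the circle at the lowest vertex of one path, put at residue 0, turns
    circular placements into linear ones. *)
Lemma spaced_tight_placed (T : finType) (E : rel T) p (m : nat)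
    (C : {set #|T|.-bseq T}) (h f : {ffun T -> 'I_p.+2}) (r : #|T|.-bseq T) x0 :
  0 < m -> m < p.+2 -> cover_of E setT C -> r \in C -> x0 \in r ->
  (spaced m f && [forall p in C, sorted (cyc_tight m f) p]) && (f (last x0 r) == 0%R) =
  placed m 0 setT C h f && has (fun x => f x == 0 :> nat) r.
Proof.
move=> m0 mq CU rC x0r; have /cover_ofP[hp hd hU] := CU.
have r0 : 0 < size r.
  by rewrite lt0n size_eq0; apply: contraTneq x0r => e; rewrite (mem_bseqE e).
have lr : last x0 r \in r by rewrite -nth_last; apply: mem_nth; rewrite prednK.
set l := last x0 r in lr *.
apply/andP/andP => [[/andP[/spacedP H1 /forall_inP H2] /eqP fl]|[/placedP[_ H2 H3 H4] h0]].
- have far x z : x != z -> f z <= f x -> f z + m <= f x.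
    move=> xz le; rewrite leqNgt; apply/negP => lt.
    have dm : f x - f z < m by lia.
    have /negP := H1 x z _ xz dm; apply; apply/Zp_subE; first by apply: ltn_trans mq.
    by left; lia.
  have fit x : f x + m <= p.+2.
    have [->|xl] := eqVneq x l; first by rewrite fl /=; apply: ltnW.
    rewrite leqNgt; apply/negP => lt; have := ltn_ord (f x) => fx.
    have dm : p.+2 - f x < m by lia.
    have lx : l != x by rewrite eq_sym.
    have /negP := H1 l x _ lx dm; apply.
    by apply/Zp_subE; [apply: ltn_trans mq | right; rewrite fl /=; lia].
  split; last by apply/hasP; exists l; rewrite ?fl.
  apply/placedP; split=> [x|x _|x z _ _ xz|s sC]; rewrite ?inE //.
    case: (leqP (f z) (f x)) => [/(far _ _ xz)|/ltnW le]; [by right|left].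
    by apply: far le; rewrite eq_sym.
  apply/(sortedP x0) => i lt; have := H2 s sC => /(sortedP x0)/(_ i lt).
  rewrite /cyc_tight /tight => /Zp_addE[//|-> //|e]; exfalso.
  (* a tight step wrapping around 0 would leave l, the end of its path *)
  have z0 : f (nth x0 s i) = 0%R.
    by apply/val_inj; have := fit (nth x0 s i.+1); move: e => /=; lia.
  have lE : nth x0 s i = l.
    apply/eqP/negPn/negP => nl; have /negP := H1 _ _ 0 nl m0; apply.
    by rewrite z0 fl GRing.subrr.
  have sr : s = r.
    by apply: (hd s r l) => //; rewrite -lE; apply: mem_nth; apply: ltnW.
  have ui := dipath_uniq (hp s sC).
  have sp : 0 < size s by apply: leq_ltn_trans lt.
  have := lE; rewrite /l -sr -nth_last => /eqP; rewrite nth_uniq ?prednK //; last exact: ltnW.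
  by move/eqP => ei; move: lt; rewrite ei prednK // ltnn.
- have mm : {in r, forall x, 0 <= f x} by [].
  have lE := tight_nth_min x0 (H4 r rC) mm h0.
  split; last first.
    apply/eqP/val_inj; rewrite /= /l -nth_last lE prednK ?subnn ?muln0 //.
  apply/andP; split.
    apply/spacedP => x z s xz sm; apply/negP => /Zp_subE; case; first exact: ltn_trans mq.
      have [] := H3 x z (in_setT _) (in_setT _) xz; lia.
    have [_] := H2 x (in_setT _); have [_] := H2 z (in_setT _).
    have [] := H3 x z (in_setT _) (in_setT _) xz; lia.
  apply/forall_inP => s sC; apply: sub_sorted (H4 s sC) => x z /eqP e.
  by apply/Zp_addE => //; left.
Qed.

(** By rotation, [q] times the number of placements with a chosen path [r] at 0;
    these arrange the other [#|C| - 1] paths in the [q - m * size r] cells left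
    over. *)
Lemma card_spaced_tight (T : finType) (E : rel T) p (m : nat)
    (C : {set #|T|.-bseq T}) :
  0 < m -> m * #|T| < p.+2 -> 0 < #|T| -> cover_of E setT C ->
  #|[pred f : {ffun T -> 'I_p.+2} | spaced m f && [forall p in C, sorted (cyc_tight m f) p]]|
   = p.+2 * (p.+2 + #|C|.-1 - m * #|T|) ^_ #|C|.-1.
Proof.
move=> m0 mn /card_gt0P[x0 _] CU; have /cover_ofP[hp hd hU] := CU.
have [r rC x0r] : exists2 r, r \in C & x0 \in r by apply/hU.
have mq : m < p.+2.
  by apply: leq_ltn_trans mn; rewrite leq_pmulr //; apply/card_gt0P; exists x0.
set ok := (X in [pred f : {ffun T -> 'I_p.+2} | X f]).
pose h : {ffun T -> 'I_p.+2} := [ffun=> 0%R].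
set l := last x0 r.
have card0 : #|[pred f | ok f && (f l == 0%R)]| = (p.+2 + #|C|.-1 - m * #|T|) ^_ #|C|.-1.
  have cr := card_dipath CU rC; rewrite cardsT in cr.
  have cC := cardsD1 r C; rewrite rC in cC.
  have fit : 0 + m * size r <= p.+2.
    by apply: leq_trans (ltnW mn); rewrite leq_mul2l (leq_trans (leq_addr _ _) (eq_leq cr)) orbT.
  have -> : (p.+2 + #|C|.-1 - m * #|T|) ^_ #|C|.-1 =
     (p.+2 + #|C :\ r| - (0 + m * size r + m * #|setT :\: [set x in r]|)) ^_ #|C :\ r|.
    by rewrite add0n -mulnDr cr cC.
  rewrite -(card_placed (place_path m 0 r h) m0 (cover_of_del CU rC) fit).
  apply: eq_card => f; rewrite !inE /ok.
  by rewrite (spaced_tight_placed h f m0 mq CU rC x0r) (placed_path 0 h f m0 CU rC) fit.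
have ok_shift (c : 'I_p.+2) (f : {ffun T -> 'I_p.+2}) : ok [ffun x => f x + c]%R = ok f.
  rewrite /ok; congr (_ && _).
    rewrite /spaced; apply: eq_forallb => x; apply: eq_forallb => z; congr (_ ==> _).
    apply: eq_forallb => s; rewrite !ffunE.
    by rewrite GRing.opprD GRing.addrACA GRing.subrr GRing.addr0.
  apply: eq_forallb => s; congr (_ ==> _); apply: eq_sorted => x z.
  by rewrite /cyc_tight !ffunE GRing.addrAC (inj_eq (@GRing.addIr _ _)).
rewrite -[LHS]sum1_card (partition_big (fun f : {ffun T -> 'I_p.+2} => f l) xpredT) //=.
rewrite (eq_bigr (fun=> #|[pred f | ok f && (f l == 0%R)]|)).
  by rewrite sum_nat_const card_ord card0.
move=> c _; rewrite -[RHS]sum1_card.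
pose sh (c : 'I_p.+2) (f : {ffun T -> 'I_p.+2}) := [ffun x => f x + c]%R.
rewrite (reindex_onto (sh c) (sh (- c)%R)) /=.
  apply: eq_bigl => f; rewrite !inE ok_shift ffunE.
  rewrite (_ : sh _ (sh c f) = f) ?eqxx ?andbT; last first.
    by apply/ffunP => x; rewrite !ffunE GRing.addrK.
  by rewrite -[X in _ == X]GRing.add0r (inj_eq (@GRing.addIr _ _)).
by move=> f _; apply/ffunP => x; rewrite !ffunE GRing.addrNK.
Qed.

(** * Spaced maps without tight arcs *)

Lemma Zp_natr_val p (u : 'I_p.+2) : (nat_of_ord u)%:R%R = u.
Proof. by apply/val_inj; rewrite Zp_nat /= modn_small. Qed.

(** The [m] residues below and including each value of [f] number at most
    [m * #|T|], hence miss some [c]: no value of [f] lies in [c, c + m). *)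
Lemma free_window (T : finType) p m (f : T -> 'I_p.+2) :
  m * #|T| < p.+2 -> exists c, forall x, m <= (f x - c)%R.
Proof.
move=> mn; pose g (u : T * 'I_m) : 'I_p.+2 := (f u.1 - (u.2 : nat)%:R)%R.
have [c cP] : exists c, c \notin codom g.
  apply/existsP; rewrite -negb_forall; apply/negP => /forallP H.
  have : #|[pred c in codom g]| <= #|{: T * 'I_m}| by apply: leq_image_card.
  rewrite (eq_card (B := 'I_p.+2)) => [|c]; last by rewrite !inE; have := H c.
  by rewrite card_ord card_prod card_ord; lia.
exists c => x; rewrite leqNgt; apply/negP => lt; case/negP: cP.
apply/codomP; exists (x, Ordinal lt); rewrite /g /=.
have -> : (nat_of_ord (f x - c)%R)%:R%R = (f x - c)%R by exact: Zp_natr_val.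
by rewrite GRing.opprB GRing.addrC GRing.addrNK.
Qed.

(** With the circle cut at a window of [m] missed residues, a difference of at
    most [m] modulo [q] cannot wrap around. *)
Lemma lift_diff p m (c u v : 'I_p.+2) s :
  m < p.+2 -> m <= (u - c)%R -> s <= m -> (u - v = s%:R)%R ->
  (u - c)%R = (v - c)%R + s :> nat.
Proof.
move=> mq mu sm uv.
have /eqP : ((u - c) - (v - c) = s%:R)%R.
  by rewrite GRing.opprB GRing.addrA GRing.addrNK.
case/Zp_subE => //; first exact: leq_ltn_trans mq.
have := ltn_ord (v - c)%R; lia.
Qed.

Lemma card_cover_le (T : finType) (E : rel T) (U : {set T}) C :
  cover_of E U C -> #|C| <= #|U|.
Proof.
move=> CU; have /cover_ofP[hp hd hU] := CU.
have [->|[q qC]] := set_0Vmem C; first by rewrite cards0.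
have [x0 _] := dipath_ex_mem (hp q qC).
have hin (p : #|T|.-bseq T) : p \in C -> head x0 p \in p.
  by move=> /hp; case: p => -[|x p] i // _; rewrite inE eqxx.
have inj : {in C &, injective (fun p : #|T|.-bseq T => head x0 p)}.
  by move=> r s rC sC e; apply: hd (hin r rC) _; rewrite // e; apply: hin.
rewrite -(card_in_imset inj) subset_leq_card //; apply/subsetP => _ /imsetP[p pC ->].
by apply/hU; exists p; rewrite ?hin.
Qed.

Lemma spaced_inj (T : finType) p m (f : {ffun T -> 'I_p.+2}) :
  0 < m -> spaced m f -> injective f.
Proof.
move=> m0 /spacedP H x z e; apply/eqP/negPn/negP => xz.
by have := H x z 0 xz m0; rewrite e GRing.subrr eqxx.
Qed.

Local Open Scope ring_scope.

(** Inclusion-exclusion: [signed_cover_sum], applied to the tight arcs of a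
    spaced [f], turns the condition that [f] has no tight arc of [D] into a
    signed sum over path covers of [D]; the sums are then exchanged. *)
Lemma card_avoid (T : finType) (D : rel T) p m :
  (0 < m)%N -> (m * #|T| < p.+2)%N -> (0 < #|T|)%N ->
  #|[pred f : {ffun T -> 'I_p.+2} |
      spaced m f && [forall x, forall z, D x z ==> ~~ cyc_tight m f x z]]|%:R =
  \sum_(C | path_cover D C) (-1) ^+ (#|T| - #|C|) *
     (p.+2 * (p.+2 + #|C|.-1 - m * #|T|) ^_ #|C|.-1)%N%:R :> int.
Proof.
move=> m0 mn T0.
have mq : (m < p.+2)%N by apply: leq_ltn_trans mn; rewrite leq_pmulr.
pose E (f : {ffun T -> 'I_p.+2}) : rel T := fun x z => D x z && cyc_tight m f x z.
have covE (f : {ffun T -> 'I_p.+2}) (C : {set #|T|.-bseq T}) : cover_of (E f) setT C =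
    cover_of D setT C && [forall s in C, sorted (cyc_tight m f) s].
  rewrite /cover_of [RHS]andbAC; congr (_ && _).
  apply/forall_inP/andP => [H|[/forall_inP H2 /forall_inP H1] s sC].
    split; apply/forall_inP => s sC; have /and3P[nz us ss] := H s sC.
      by rewrite /dipath nz us; apply: sub_sorted ss => x z /andP[].
    by apply: sub_sorted ss => x z /andP[].
  have /and3P[nz us ss] := H2 s sC; rewrite /dipath nz us /=.
  have [x0 _] := dipath_ex_mem (H2 s sC).
  apply/(sortedP x0) => i lt; rewrite /E.
  by move/(sortedP x0): ss => ->; rewrite //= (sortedP x0 (H1 s sC)).
(* cutting the circle gives the potential that makes tight arcs acyclic *)
have signed (f : {ffun T -> 'I_p.+2}) : spaced m f ->
   [forall x, forall z, D x z ==> ~~ cyc_tight m f x z]%:R =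
   \sum_(C | path_cover D C && [forall s in C, sorted (cyc_tight m f) s])
      (-1) ^+ (#|T| - #|C|) :> int.
  move=> sf; have [c cP] := free_window f mn.
  have inj := spaced_inj m0 sf.
  have H : \sum_(C | cover_of (E f) [set: T] C) (-1) ^+ #|C| =
    (-1) ^+ #|[set: T]| *+ [forall x in [set: T], forall z in [set: T], ~~ E f x z] :> int.
    apply: (signed_cover_sum (y := fun x => (f x - c)%R)) 
      => [x z /andP[_ t]|x z z' /andP[_ /eqP t] /andP[_ /eqP t']
         |x x' z /andP[_ /eqP t] /andP[_ /eqP t']].
    - have -> : nat_of_ord (f x - c) = (nat_of_ord (f z - c)%R + m)%N.
        apply: (lift_diff mq (cP x) (leqnn m)); apply/eqP.
        by rewrite subr_eq addrC -(eqP t).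
      by rewrite -ltn_subLR // subnn.
    - by apply: inj; apply: (addIr m%:R); rewrite -t -t'.
    - by apply: inj; rewrite t t'.
  transitivity ((-1) ^+ #|T| * \sum_(C | cover_of (E f) [set: T] C) (-1) ^+ #|C| : int).
    rewrite H.
    rewrite cardsT mulrnAr -expr2 sqrr_sign.
    congr (_ *+ nat_of_bool _); apply/forallP/forall_inP => H' x => [_|].
      by apply/forall_inP => z _; rewrite /E negb_and -implybE; apply: (forallP (H' x)).
    apply/forallP => z; have /forall_inP/(_ z (in_setT _)) := H' x (in_setT _).
    by rewrite /E negb_and -implybE.
  rewrite mulr_sumr; apply: eq_big => [C|C CU]; first by rewrite covE cover_ofT.
  have le : (#|C| <= #|T|)%N by have := card_cover_le CU; rewrite cardsT.
  by rewrite -{1}(subnK le) exprD -mulrA -expr2 sqrr_sign mulr1.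
rewrite -sum1_card natr_sum.
transitivity (\sum_(f : {ffun T -> 'I_p.+2} | spaced m f)
   \sum_(C | path_cover D C && [forall s in C, sorted (cyc_tight m f) s])
      (-1) ^+ (#|T| - #|C|) : int).
  rewrite [RHS](eq_bigr _ (fun f sf => esym (signed f sf))) /=.
  rewrite [RHS]big_mkcond [LHS]big_mkcond; apply: eq_bigr => f _; rewrite !inE.
  by case: (spaced m f) => //=; case: [forall _, _].
rewrite (exchange_big_dep (path_cover D)) /=; last by move=> f C _ /andP[].
apply: eq_bigr => C CU; have CU' : cover_of D setT C by rewrite cover_ofT.
rewrite -(card_spaced_tight m0 mn T0 CU') sumr_const mulr_natr.
by congr (_ *+ _); apply: eq_card => f; rewrite !inE CU.
Qed.

(** * Flats of an arrangement with integer gains *)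

From mathcomp Require Import finmap boolp classical_sets cardinality.

Local Open Scope classical_set_scope.

Lemma affine_dim_unique (R : realType) n d (X : set 'rV[R]_n) :
  affine_of_dim d X -> affine_dim X = d.
Proof.
move=> dX; apply: xget_unique => // d'.
have sub d1 d2 (x1 x2 : 'rV[R]_n) (M1 : 'M_(d1, n)) (M2 : 'M_(d2, n)) :
    [set x | (x - x1 <= M1)%MS] = [set x | (x - x2 <= M2)%MS] -> (M1 <= M2)%MS.
  move=> e; apply/row_subP => i.
  have h1 : (x1 - x2 <= M2)%MS.
    suff : [set x | (x - x2 <= M2)%MS] x1 by [].
    by rewrite -e /= subrr sub0mx.
  have h2 : (row i M1 + x1 - x2 <= M2)%MS.
    suff : [set x | (x - x2 <= M2)%MS] (row i M1 + x1) by [].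
    by rewrite -e /= addrK row_sub.
  have -> : row i M1 = (row i M1 + x1 - x2) - (x1 - x2).
    by rewrite opprB addrA addrNK addrK.
  by rewrite addmx_sub // eqmx_opp.
case: dX => x1 [M1 [/eqP f1 ->]] [x2 [M2 [/eqP f2 e]]].
apply/eqP; rewrite eqn_leq -[X in (X <= _)%N]f2 -[X in (_ <= X)%N]f1 mxrankS.
  by rewrite -[X in (_ <= X)%N]f2 -[X in (X <= _)%N]f1 mxrankS //; apply: sub e.
by apply: sub; symmetry; exact: e.
Qed.

(** Here [rep] chooses a representative in each class of coordinates; the
    direction space consists of the vectors constant on classes, with basis the
    indicators of the classes. *)
Lemma affine_dim_classes (R : realType) n (X : set 'rV[R]_n) (z : 'rV[R]_n)
    (rep : 'I_n -> 'I_n) :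
  (forall i, rep (rep i) = rep i) ->
  (forall x, X x <-> forall i, x 0 i - x 0 (rep i) = z 0 i - z 0 (rep i)) ->
  affine_dim X = #|[set rep i | i in 'I_n]%SET|.
Proof.
set S := [set rep i | i in 'I_n]%SET => rr XP; apply: affine_dim_unique.
have repS i : rep i \in S by apply: imset_f.
have repK (k : 'I_#|S|) : rep (enum_val k) = enum_val k :> 'I_n.
  by have /imsetP[i _ ->] : enum_val k \in S := enum_valP k.
exists z, (\matrix_(k < #|S|, i < n) (rep i == enum_val k)%:R); split.
  apply/row_freeP; exists (\matrix_(i, k) (i == enum_val k)%:R).
  apply/matrixP => k l; rewrite !mxE (bigD1 (enum_val l)) //= big1 => [|i ne].
    by rewrite !mxE eqxx mulr1 addr0 repK (inj_eq enum_val_inj) eq_sym.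
  by rewrite !mxE (negbTE ne) mulr0.
apply/seteqP; split=> x /=.
  move=> /XP xX; apply/submxP; exists (\row_k (x - z) 0 (enum_val k)).
  apply/rowP => i; rewrite [RHS]mxE (bigD1 (enum_rank_in (repS i) (rep i))) //= big1 => [|k nk].
    rewrite !mxE enum_rankK_in // eqxx mulr1 addr0; have := xX i; lra.
  rewrite !mxE; case: eqP => [e|_]; last by rewrite mulr0.
  by case/eqP: nk; apply: enum_val_inj; rewrite enum_rankK_in.
move=> /submxP[D e]; apply/XP => i.
have cst : (x - z) 0 i = (x - z) 0 (rep i).
  by rewrite e !mxE; apply: eq_bigr => k _; rewrite !mxE rr.
by move: cst; rewrite !mxE; lra.
Qed.

(** The analogue of [affine_dim_classes] over Z_q: one free value per class. *)
Lemma card_classes (p n : nat) (rep : 'I_n -> 'I_n) (g : 'I_n -> 'I_p.+2) :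
  (forall i, rep (rep i) = rep i) ->
  #|[pred f : {ffun 'I_n -> 'I_p.+2} | [forall i, f i - f (rep i) == g i - g (rep i)]]|
  = (p.+2 ^ #|[set rep i | i in 'I_n]%SET|)%N.
Proof.
set S := [set rep i | i in 'I_n]%SET => rr.
have repS i : rep i \in S by apply: imset_f.
pose cl i := enum_rank_in (repS i) (rep i).
have clE i : enum_val (cl i) = rep i by rewrite enum_rankK_in.
have repK (k : 'I_#|S|) : rep (enum_val k) = enum_val k :> 'I_n.
  by have /imsetP[i _ ->] : enum_val k \in S := enum_valP k.
have clK (k : 'I_#|S|) : cl (enum_val k) = k by apply: enum_val_inj; rewrite clE repK.
pose F (u : {ffun 'I_#|S| -> 'I_p.+2}) : {ffun 'I_n -> 'I_p.+2} :=
  [ffun i => g i - g (rep i) + u (cl i)].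
have Finj : injective F.
  move=> u v /ffunP e; apply/ffunP => k; have := e (enum_val k).
  by rewrite !ffunE clK => /addrI.
rewrite -[in RHS](card_ord p.+2) -[X in (_ ^ X)%N](card_ord #|S|) -card_ffun.
rewrite -(card_codom Finj); apply: eq_card => f; rewrite !inE.
apply/forallP/codomP => [H|[u ->] i].
  exists [ffun k => f (enum_val k)]; apply/ffunP => i; rewrite !ffunE clE.
  by have /eqP <- := H i; rewrite subrK.
have clr : cl (rep i) = cl i by apply: enum_val_inj; rewrite !clE.
by rewrite !ffunE clr rr subrr add0r addrK.
Qed.

Definition gain_arr (R : realType) (n m : nat) (P : 'I_n -> 'I_n -> nat -> bool) :
    set (set 'rV[R]_n) :=
  [set H | exists i j s, [/\ (s <= m)%N, P i j s & H = hyp R i j s]].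

(** Call coordinates [i] and [j] equivalent when [x_i - x_j] is constant on [X].
    All gains being integers, the coordinatewise floor of a point of [X] is an
    integer point [z] of [X], and [X] consists of the points whose differences
    within each class agree with those of [z]. *)
Lemma flats_classes (R : realType) n m P (X : set 'rV[R]_n) :
  flats (gain_arr m P) X ->
  exists (z : 'I_n -> int) (rep : 'I_n -> 'I_n),
   [/\ forall i, rep (rep i) = rep i,
       forall i j s, X `<=` hyp R i j s -> rep i = rep j /\ z i - z j = s%:Z
     & forall x, X x <-> forall i, x 0 i - x 0 (rep i) = (z i)%:~R - (z (rep i))%:~R].
Proof.
move=> [[x0 Xx0] [B BA XE]].
pose e i j := `[< forall x x', X x -> X x' -> x 0 i - x 0 j = x' 0 i - x' 0 j >].
have eP i j : reflect (forall x x', X x -> X x' -> x 0 i - x 0 j = x' 0 i - x' 0 j) (e i j).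
  exact: asboolP.
have exx i : e i i by apply/eP => x x' _ _; rewrite !subrr.
have esm i j : e i j -> e j i.
  by move=> /eP h; apply/eP => x x' hx hx'; rewrite -opprB (h x x') // opprB.
have etrans i j k : e i j -> e j k -> e i k.
  move=> /eP h1 /eP h2; apply/eP => x x' hx hx'.
  have := h1 x x' hx hx'; have := h2 x x' hx hx'.
  by rewrite -[x 0 i - x 0 k](subrKA (x 0 j)) => -> ->; rewrite subrKA.
pose rep i := odflt i [pick j | e i j].
have erep i : e i (rep i) by rewrite /rep; case: pickP => //= _; apply: exx.
have repE i j : e i j -> rep i = rep j.
  move=> ij; rewrite /rep (eq_pick (Q := e j)) => [|k].
    by case: pickP => // /(_ j); rewrite exx.
  by apply/idP/idP; apply: etrans => //; apply: esm.
pose z i := Num.floor (x0 0 i).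
have zE i j s : X `<=` hyp R i j s -> z i - z j = s%:Z.
  move=> /(_ _ Xx0); rewrite /hyp /= => h.
  have {}h : x0 0 i = x0 0 j + s%:Z%:~R by rewrite -[s%:Z%:~R]h addrC subrK.
  by rewrite /z h floorDrz ?intr_int // intrKfloor addrC addKr.
have XB H : B H -> X `<=` H by move=> BH x; rewrite XE => /(_ _ BH).
pose zr : 'rV[R]_n := \row_i (z i)%:~R.
have Xz : X zr.
  rewrite XE => H BH; have [i [j [s [_ _ HE]]]] := BA _ BH.
  rewrite HE /hyp /= !mxE -rmorphB /= (zE i j s) //.
  by rewrite -HE; apply: XB.
exists z, rep; split.
- by move=> i; apply/esym/repE.
- move=> i j s XH; split; last exact: zE.
  by apply: repE; apply/eP => x x' /XH + /XH; rewrite /hyp /= => -> ->.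
- move=> x; split=> [Xx i|h].
    by have /eP/(_ x zr Xx Xz) := erep i; rewrite !mxE.
  rewrite XE => H BH; have [i [j [s [_ _ HE]]]] := BA _ BH.
  have XH : X `<=` hyp R i j s by rewrite -HE; apply: XB.
  have rij : rep i = rep j.
    by apply: repE; apply/eP => y y' /XH + /XH; rewrite /hyp /= => -> ->.
  have zij := zE i j s XH.
  rewrite HE /hyp /=; have := h j; have := h i; rewrite rij => hi hj.
  have zR : (z i)%:~R - (z j)%:~R = s%:R :> R by rewrite -rmorphB /= zij.
  by move: hi hj zR; lra.
Qed.

Lemma finite_gain_arr (R : realType) n m P : finite_set (@gain_arr R n m P).
Proof.
apply: (sub_finite_set (B := (fun t : 'I_n * 'I_n * 'I_m.+1 => hyp R t.1.1 t.1.2 t.2) @` setT)).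
  by move=> H [i [j [s [sm _ ->]]]]; exists (i, j, inord s) => //=; rewrite inordK.
exact: finite_image.
Qed.

Lemma finite_flats (R : realType) n (A : set (set 'rV[R]_n)) :
  finite_set A -> finite_set (flats A).
Proof.
move=> /finite_seqP[s As].
apply: (sub_finite_set (B := (fun b : {ffun 'I_(size s) -> bool} =>
   \bigcap_(H in [set H | exists2 i, b i & H = nth setT s (val i)]) H) @` setT));
  last exact: finite_image.
move=> X [_ [B BA ->]]; exists [ffun i => `[< B (nth setT s (val i)) >]] => //.
congr (bigcap _ _); apply/seteqP; split=> H /=.
  by move=> [i]; rewrite ffunE => /asboolP Bi ->.
move=> BH; have : H \in s by have := BA _ BH; rewrite As.
move=> Hs; have lt : (index H s < size s)%N by rewrite index_mem.
exists (Ordinal lt); rewrite ?ffunE /= ?nth_index //.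
exact/asboolP.
Qed.

(** The flats containing [y] are those below the smallest one, the intersection
    [Z] of the members of [A] through [y]; the Moebius function sums to 0 over
    them unless [Z] is the whole space. *)
Lemma sum_mobius_point (R : realType) n (A : set (set 'rV[R]_n)) (y : 'rV[R]_n) :
  finite_set A -> ~ A setT ->
  \sum_(X <- fset_set (flats A) | y \in X)
     mobius (fset_set (flats A)) (@reverse_incl _) setT X =
  (`[< forall H, A H -> ~ H y >])%:R :> int.
Proof.
move=> finA AT; set L := fset_set _.
have inL X : (X \in L) = `[< flats A X >].
  by rewrite in_fset_set; [apply/idP/asboolP; rewrite inE | exact: finite_flats].
pose Z := \bigcap_(H in [set H | A H /\ H y]) H.
have Zy : Z y by move=> H [].
have ZL : Z \in L.
  rewrite inL; apply/asboolP; split; first by exists y.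
  by exists [set H | A H /\ H y] => // H [].
have yZ X : X \in L -> (y \in X) = reverse_incl X Z.
  rewrite inL => /asboolP[_ [B BA XE]]; apply/idP/asboolP; rewrite inE; last exact.
  rewrite XE => yX x Zx H BH; apply: Zx; split; [exact: BA | exact: yX].
have lerefl : reflexive (@reverse_incl 'rV[R]_n) by move=> X; apply/asboolP.
have leanti : antisymmetric (@reverse_incl 'rV[R]_n).
  by move=> X Y /andP[/asboolP h1 /asboolP h2]; apply/seteqP.
have letrans : transitive (@reverse_incl 'rV[R]_n).
  by move=> X Y W /asboolP h1 /asboolP h2; apply/asboolP; apply: subset_trans h1.
have le0 (X : set 'rV[R]_n) : reverse_incl setT X by apply/asboolP.
rewrite big_seq_cond (eq_bigl (fun X => (X \in L) && reverse_incl X Z)) => [|X]; last first.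
  by case: (boolP (X \in L)) => //= /yZ ->.
rewrite -big_seq_cond big_mkcond (bigD1_seq Z) ?fset_uniq //= lerefl -big_mkcondr /=.
rewrite mobiusE //.
have -> : `[< forall H, A H -> ~ H y >] = (setT == Z).
  apply/asboolP/eqP => [h|ZT H AH Hy].
    by rewrite /Z; apply/seteqP; split=> // x _ H [AH Hy]; case: (h H).
  apply: AT; have -> : setT = H; last by [].
  by apply/seteqP; split=> // x _; have : Z x by [rewrite -ZT]; apply.
case: eqP => [ZT|_].
  rewrite big1_seq ?addr0 // => X /andP[/andP[nX /asboolP ZX] _].
  have XZ : (X : set 'rV[R]_n) = Z.
    by apply/seteqP; split=> [x _|x Zx]; [rewrite -ZT | apply: ZX].
  by rewrite XZ eqxx in nX.
rewrite le0; apply/eqP; rewrite addrC subr_eq0; apply/eqP.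
by apply: eq_bigl => X; rewrite le0 andbC.
Qed.

Local Close Scope classical_set_scope.

(** * Evaluation of the characteristic polynomial *)

(** A residue at which the circle can be cut, see [free_window]. *)
Definition cut_point n p m (f : 'I_n -> 'I_p.+2) : 'I_p.+2 :=
  odflt 0 [pick c | [forall i, (m <= (f i - c)%R)%N]].

Lemma cut_pointP n p m (f : 'I_n -> 'I_p.+2) i :
  (m * n < p.+2)%N -> (m <= (f i - cut_point m f)%R)%N.
Proof.
rewrite -[in (_ * n)%N](card_ord n) => mn; rewrite /cut_point; case: pickP => [c /forallP//|H].
by have [c /forallP] := free_window f mn; rewrite H.
Qed.

Definition lift_row (R : realType) n p m (f : 'I_n -> 'I_p.+2) : 'rV[R]_n :=
  \row_i (nat_of_ord (f i - cut_point m f)%R)%:R.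

(** The lift of [f] to an integer point satisfies over the reals exactly the
    equations, with gains up to [m], that [f] satisfies modulo [q]. *)
Lemma lift_row_hyp (R : realType) n p m (f : 'I_n -> 'I_p.+2) i j s :
  (m * n < p.+2)%N -> (s <= m)%N ->
  hyp R i j s (lift_row R m f) <-> f i - f j = s%:R.
Proof.
move=> mn sm; rewrite /hyp /= !mxE; set c := cut_point m f.
have mq : (m < p.+2)%N.
  by apply: leq_ltn_trans mn; rewrite leq_pmulr // (leq_ltn_trans _ (ltn_ord i)).
split=> [/eqP|fij].
  rewrite subr_eq -natrD eqr_nat => /eqP e.
  have : (f i - c) = s%:R + (f j - c).
    by rewrite -[LHS]Zp_natr_val e natrD Zp_natr_val.
  by rewrite addrA => /addIr ->; rewrite addrK.
by rewrite (lift_diff mq (cut_pointP f i mn) sm fij) natrD addrC addKr.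
Qed.

(** Modulo [q], as over R, membership in [X] prescribes the differences within
    each class of coordinates. *)
Lemma card_flat (R : realType) n p m P (X : set 'rV[R]_n) :
  (m * n < p.+2)%N -> flats (gain_arr m P) X ->
  #|[pred f : {ffun 'I_n -> 'I_p.+2} | lift_row R m f \in X]| =
  (p.+2 ^ affine_dim X)%N.
Proof.
move=> mn XF; have [z [rep [rr zE XP]]] := flats_classes XF.
rewrite (@affine_dim_classes _ _ X (\row_i (z i)%:~R) rep) //; last first.
  by move=> x; split=> [/XP h i|h]; [rewrite !mxE | apply/XP => i; rewrite h !mxE].
rewrite -(card_classes (fun i => (z i)%:~R) rr); apply: eq_card => f; rewrite !inE.
apply/idP/forallP => [|H]; rewrite inE.
  move=> /XP H i; have := H i; rewrite !mxE => /eqP.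
  set a := nat_of_ord _; set b := nat_of_ord _.
  rewrite -[a%:R]/(a%:Z%:~R) -[b%:R]/(b%:Z%:~R) -!rmorphB /= eqr_int => /eqP e.
  have := congr1 (fun t : int => t%:~R : 'I_p.+2) e.
  rewrite !rmorphB /= -[_%:~R]/(a%:R) -[X in _ - X]/(b%:R) !Zp_natr_val.
  by rewrite opprB addrA subrK => ->.
have [_ [B BA XE]] := XF; rewrite XE => Y BY.
have [i [j [s [sm _ YE]]]] := BA _ BY.
have [rij zij] : rep i = rep j /\ z i - z j = s%:Z.
  by apply: zE; rewrite -YE XE => x; apply.
rewrite YE; apply/(lift_row_hyp _ _ _ _ mn sm).
have /eqP hi := H i; have /eqP := H j; rewrite -rij => hj.
rewrite -[f i](subrK (f (rep i))) hi -[f j](subrK (f (rep i))) hj.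
rewrite opprD addrACA subrr addr0 opprB subrKA.
by rewrite -rmorphB /= zij.
Qed.

(** The finite field method: summing the Moebius function over the pairs of a
    flat [X] and an [f] with lift in [X], [card_flat] gives the value of the
    characteristic polynomial and [sum_mobius_point] the number of [f] whose
    lift avoids the arrangement. *)
Lemma char_poly_eval (R : realType) n p m (P : 'I_n -> 'I_n -> nat -> bool) :
  (m * n < p.+2)%N -> (forall i j s, P i j s -> i != j) ->
  (char_poly_arr (@gain_arr R n m P)).[p.+2%:R] =
  #|[pred f : {ffun 'I_n -> 'I_p.+2} |
     [forall i, forall j, forall s : 'I_m.+1, P i j s ==> (f i - f j != s%:R)]]|%:R.
Proof.
move=> mn Pne; rewrite /char_poly_arr; set A := gain_arr m P; set L := fset_set _.
have finA : finite_set A by exact: finite_gain_arr.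
have AT : ~ A setT.
  case=> i [j [s [_ /Pne ij HT]]].
  have h1 : hyp R i j s 0 by rewrite -HT.
  have h2 : hyp R i j s (delta_mx 0 i) by rewrite -HT.
  move: h1 h2; rewrite /hyp /= !mxE subrr eqxx (eq_sym j) (negbTE ij) => <-.
  by rewrite subr0 => /eqP; rewrite oner_eq0.
rewrite horner_sum.
transitivity (\sum_(X <- L) \sum_(f : {ffun 'I_n -> 'I_p.+2} | lift_row R m f \in X)
   mobius L (@reverse_incl _) setT X).
  rewrite big_seq [RHS]big_seq; apply: eq_bigr => X XL.
  rewrite hornerZ hornerXn -natrX sumr_const -(@card_flat R n p m P X mn) ?mulr_natr //.
  by move: XL; rewrite in_fset_set ?inE //; exact: finite_flats.
rewrite (exchange_big_dep xpredT) //= -sum1_card natr_sum [RHS]big_mkcond /=.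
apply: eq_bigr => f _; rewrite sum_mobius_point // inE.
rewrite -[RHS]/(if _ then 1 else 0); set b := [forall i, _].
have -> : `[< forall H, A H -> ~ H (lift_row R m f) >] = b; last by case: b.
apply/asboolP/forallP => [h i|h H [i [j [s [sm Pij ->]]]]].
  apply/forallP => j; apply/forallP => s; apply/implyP => Pij; apply/eqP => e.
  have sm : (s <= m)%N by rewrite -ltnS.
  by apply: (h (hyp R i j s)); [exists i, j, s | apply/lift_row_hyp].
move/(lift_row_hyp _ _ _ _ mn sm) => e; have sm' : (s < m.+1)%N by [].
by have /forallP/(_ j)/forallP/(_ (Ordinal sm'))/implyP/(_ Pij)/eqP := h i.
Qed.

(** For [m > 0] the deleted hyperplanes are determined by their arcs, so deleting
    them deletes nothing else; the two test points are multiples of basis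
    vectors. *)
Lemma hyp_gain_inj (R : realType) n (i j i' j' : 'I_n) s m :
  i != j -> (0 < m)%N -> hyp R i j s = hyp R i' j' m -> [/\ i = i', j = j' & s = m].
Proof.
move=> ij m0 e.
have h1 : hyp R i' j' m (s%:R *: delta_mx 0 i).
  by rewrite -e /hyp /= !mxE eqxx (eq_sym j) (negbTE ij) mulr1 mulr0 subr0.
have h2 : hyp R i' j' m (- (s%:R *: delta_mx 0 j)).
  by rewrite -e /hyp /= !mxE eqxx (negbTE ij) mulr1 mulr0 oppr0 sub0r opprK.
move: h1 h2; rewrite /hyp /= !mxE !eqxx /= {e}.
have m0R : 0 < m%:R :> R by rewrite ltr0n.
have s0R : 0 <= s%:R :> R by rewrite ler0n.
case: (i' =P i) => [->|_]; case: (j' =P j) => [->|_]; case: (j' == i); case: (j == i);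
  case: (i == j); case: (i' == j); rewrite /= ?mulr0 ?mulr1 => h1 h2;
  try (exfalso; lra); split=> //; apply/eqP; rewrite -(eqr_nat R); apply/eqP; lra.
Qed.

Lemma catalan_delE (R : realType) n m (G : rel 'I_n) :
  (0 < m)%N -> irreflexive G ->
  catalan_del R m G =
  gain_arr m (fun i j s => (i != j) && ((s == m) ==> ~~ G i j)).
Proof.
move=> m0 irrG; apply/seteqP; split=> H.
  case=> -[[i [j [ij ->]]]|[i [j [s [ij /andP[s0 sm] ->]]]]] nG.
    exists i, j, 0%N; split=> //; rewrite neq_ltn ij /=.
    by rewrite (ltn_eqF m0).
  exists i, j, s; split=> //; rewrite ij; apply/implyP => /eqP e.
  by apply/negP => Gij; apply: nG; exists i, j; rewrite -e.
case=> i [j [s [sm /andP[ij /implyP nG] ->]]]; split; last first.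
  move=> [i' [j' [Gij /(hyp_gain_inj ij m0)[ei ej es]]]].
  by move: nG; rewrite ei ej es eqxx Gij => /(_ isT).
case: s sm {nG} => [|s] sm; last by right; exists i, j, s.+1.
left; have [lt|lt|e] := ltngtP i j; first by exists i, j.
  exists j, i; split=> //; apply/seteqP; split=> x; rewrite /hyp /= => /eqP;
  by rewrite subr_eq0 eq_sym -subr_eq0 => /eqP.
by case/eqP: ij; apply: val_inj.
Qed.

(** * The path cover formula *)

Lemma poly_int_eq_large (A B : {poly int}) N :
  (forall p, (N <= p)%N -> A.[p%:R] = B.[p%:R]) -> A = B.
Proof.
move=> H; apply/eqP; rewrite -subr_eq0; apply/eqP.
pose rs : seq int := [seq (N + i)%N%:R | i <- iota 0 (size (A - B))].
apply: (@roots_geq_poly_eq0 _ _ rs).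
- apply/allP => _ /mapP[i _ ->]; rewrite /root hornerD hornerN H ?subrr //.
  exact: leq_addr.
- rewrite map_inj_uniq ?iota_uniq // => i j /eqP.
  by rewrite eqr_nat eqn_add2l => /eqP.
- by rewrite size_map size_iota.
Qed.

Lemma falling_nat (N k : nat) : (k <= N)%N -> falling (N%:R : int) k = (N ^_ k)%:R.
Proof.
move=> kN; rewrite ffact_prod natr_prod; apply: eq_bigr => i _.
by rewrite natrB // ltnW // (leq_trans (ltn_ord i)).
Qed.

Lemma sum_path_covers n (D : rel 'I_n) (F : nat -> int) : (0 < n)%N ->
  \sum_(C | path_cover D C) F #|C| =
  \sum_(1 <= k < n.+1) (num_path_covers D k)%:R * F k.
Proof.
move=> n0.
transitivity (\sum_(1 <= k < n.+1) \sum_(C | path_cover D C && (#|C| == k)) F k); last first.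
  apply: eq_bigr => k _; rewrite sumr_const mulr_natl; congr (_ *+ _).
rewrite (exchange_big_dep (path_cover D)) /=; last by move=> k C _ /andP[].
apply: eq_bigr => C CU; rewrite CU /=.
have CU' : cover_of D [set: 'I_n]%SET C by rewrite cover_ofT.
rewrite (eq_bigl (fun k => k == #|C|)) => [|k]; last by rewrite eq_sym.
rewrite big_nat1_eq ltnS.
have cT : #|[set: 'I_n]%SET| = n by rewrite cardsT card_ord.
by rewrite (cover_of_card_gt0 CU') ?cT // (leq_trans (card_cover_le CU')) ?cT.
Qed.

Theorem theorem3p1 (R : realType) (n m : nat) (hn : (1 <= n)%N) (hm : (1 <= m)%N)
    (G : rel 'I_n) (hG : irreflexive G) :
  char_poly_arr (catalan_del R m G) =
  'X * \sum_(1 <= k < n.+1)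
         (-1) ^+ (n - k) * (num_path_covers (digraph_compl G) k)%:R *
         falling ('X - (m * n)%:R + k%:R - 1) (k - 1).
Proof.
apply: (@poly_int_eq_large _ _ (m * n).+2) => q; case: q => [//|[//|p]] mn.
have {}mn : (m * n < p.+2)%N by apply: leq_trans mn; apply: ltnW.
rewrite catalan_delE // char_poly_eval //; last by move=> i j s /andP[].
set D := digraph_compl G.
have -> : #|[pred f : {ffun 'I_n -> 'I_p.+2} | [forall i, forall j, forall s : 'I_m.+1,
   ((i != j) && ((s == m :> nat) ==> ~~ G i j)) ==> (f i - f j != s%:R)]]|
  = #|[pred f : {ffun 'I_n -> 'I_p.+2} |
      spaced m f && [forall x, forall z, D x z ==> ~~ cyc_tight m f x z]]|.
  apply: eq_card => f; rewrite !inE; apply/forallP/andP => [H|[/spacedP H1 /forallP H2] i].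
    have {}H i j s : i != j -> (s <= m)%N -> (s == m) ==> ~~ G i j -> f i - f j != s%:R.
      move=> ij sm Gij; have sm' : (s < m.+1)%N by [].
      by have /forallP/(_ j)/forallP/(_ (Ordinal sm'))/implyP := H i; apply; rewrite ij.
    split.
      apply/spacedP => x z s xz sm; apply: H => //; first exact: ltnW.
      by rewrite (ltn_eqF sm).
    apply/forallP => x; apply/forallP => z; apply/implyP => /andP[xz nG].
    by rewrite /cyc_tight addrC -subr_eq; apply: H; rewrite // nG implybT.
  apply/forallP => j; apply/forallP => s; apply/implyP => /andP[ij nG].
  have [e|ne] := eqVneq (s : nat) m.
    have /forallP/(_ j)/implyP := H2 i; rewrite /D /digraph_compl ij /=.
    by move: nG; rewrite e eqxx /= /cyc_tight => nG /(_ nG); rewrite addrC subr_eq.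
  by apply: H1; rewrite // ltn_neqAle ne -ltnS ltn_ord.
rewrite card_avoid ?card_ord //.
pose F k : int := (-1) ^+ (#|'I_n| - k) *
   (p.+2 * (p.+2 + k.-1 - m * #|'I_n|) ^_ k.-1)%N%:R.
rewrite -[LHS]/(\sum_(C | path_cover D C) F #|C|) sum_path_covers // /F card_ord.
have horner_nat k : (k%:R : {poly int}).[p.+2%:R] = k%:R.
  exact: (rmorph_nat (horner_eval _)).
rewrite hornerM hornerX horner_sum mulr_sumr.
rewrite big_nat [RHS]big_nat; apply: eq_bigr => k /andP[k0 kn].
rewrite !hornerM horner_exp hornerN (horner_nat 1%N) horner_nat natrM /falling horner_prod.
have -> : \prod_(i < k - 1) ('X - (m * n)%:R + k%:R - 1 - i%:R).[p.+2%:R] =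
   falling ((p.+2 + k.-1 - m * n)%N%:R : int) k.-1.
  rewrite subn1; apply: eq_bigr => i _.
  rewrite !(hornerD, hornerN, hornerX, horner_nat, horner_nat 1%N).
  congr (_ - _); rewrite natrB; last by lia.
  rewrite natrD -subn1 natrB //; lra.
rewrite falling_nat; last by lia.
ring.
Qed.
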